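(* Let $X$ be a completely regular space. Let $H$ be a non-vanishing closed ideal in $C_B(X)$. The following are equivalent: (1) $\mathfrak{sp}(H)$ is countably compact. (2) For every sequence $H_1,H_2,\ldots$ of closed subideals of $H$, if $H=\overline{\sum_{n=1}^\infty H_n}$ then $H=\overline{\sum_{n=1}^m H_n}$ for some positive integer $m$. (3) For every sequence $H_1\subseteq H_2\subseteq\cdots$ of proper closed subideals of $H$ we have $H\neq\overline{\bigcup_{n=1}^\infty H_n}$. Here the bar denotes the closure in $C_B(X)$.
   Context: Completely regular spaces are assumed Hausdorff. The scalar field $\mathbb{F}$ is fixed and is $\mathbb{R}$ or $\mathbb{C}$. $C_B(X)$ is the Banach algebra of all bounded continuous mappings $X\to\mathbb{F}$ with pointwise addition and multiplication and the supremum norm. $\beta X$ is the Stone–Čech compactification of $X$ (containing $X$ as a dense subspace), and for $f\in C_B(X)$, $f_\beta:\beta X\to\mathbb{F}$ is its unique continuous extension. For $f:Y\to\mathbb{F}$, $\mathrm{coz}(f)=\{y\in Y:f(y)\neq0\}$. An ideal $H$ of $C_B(X)$ is non-vanishing if for every $x\in X$ there is $h\in H$ with $h(x)\neq0$. For a non-vanishing closed ideal $H$ of $C_B(X)$, its spectrum is the subspace $\mathfrak{sp}(H)=\bigcup_{h\in H}\mathrm{coz}(h_\beta)$ of $\beta X$. A closed subideal of $H$ is a closed ideal of $C_B(X)$ contained in $H$; it is proper if it is not equal to $H$. $\sum_{n=1}^\infty H_n$ is the algebraic sum, i.e. the set of all finite sums of elements of the $H_n$. A Hausdorff space is countably compact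 if every countable open cover of it has a finite subcover. *)

(* Defs.v *)
From HB Require Import structures.
From mathcomp Require Import all_boot all_order all_algebra.
From mathcomp Require Import complex.
From mathcomp Require Import all_classical all_reals.
From mathcomp Require Import topology normedtype.

Set Implicit Arguments.
Unset Strict Implicit.
Unset Printing Implicit Defensive.

Import Order.TTheory GRing.Theory Num.Theory.
Import numFieldNormedType.Exports.

Local Open Scope classical_set_scope.
Local Open Scope ring_scope.

Variant scalar_kind := RealScalars | ComplexScalars.

Definition scalars (R : realType) (k : scalar_kind) : numFieldType :=
  match k with RealScalars => R | ComplexScalars => R[i] end.

(* The least upper bound is taken in the order of the scalar field itself; on
   C, a bounded set of nonnegative elements has its usual real supremum. *)
Lemma scalars_sup (R : realType) k (A : set (scalars R k)) :
  (forall a, A a -> 0 <= a) -> has_sup A -> supremums A !=set0.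
Proof.
case: k A => A A0 [] [a Aa] [M AM].
  have hA : has_sup (A : set R) by split; [exists a | exists M].
  exists (sup (A : set R)); split; first exact: (ub_le_sup hA.2).
  by move=> b Ab; apply: ge_sup hA.1 _ => x /Ab.
pose B : set R := [set complex.Re z | z in (A : set R[i])].
have im0 (z : R[i]) : 0 <= z -> complex.Im z = 0.
  by rewrite lecE /= => /andP[/eqP].
have hB : has_sup B.
  split; first by exists (complex.Re (a : R[i])), a.
  exists (complex.Re (M : R[i])) => _ [z Az <-].
  by have := AM z Az; rewrite lecE => /andP[].
exists ((sup B)%:C%C : R[i]); split.
  move=> z Az; rewrite lecE /= (im0 _ (A0 z Az)) eqxx /=.
  by apply: (ub_le_sup hB.2); exists z.
move=> b Ab; rewrite lecE /= (im0 b) ?eqxx /=; last first.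
  exact: le_trans (A0 a Aa) (Ab a Aa).
apply: ge_sup hB.1 _ => _ [z Az <-].
by have := Ab z Az; rewrite lecE => /andP[].
Qed.

Section CB.
Variables (R : realType) (k : scalar_kind) (X : topologicalType).
Local Notation F := (scalars R k).

Definition bcont : {pred X -> F} :=
  fun f => `[< continuous f /\ bounded_fun f >].

Lemma bcontP f : reflect (continuous f /\ exists M, forall x, `|f x| <= M)
                         (f \in bcont).
Proof.
apply: (iffP (asboolP _)) => -[cf bf]; split=> //.
  have [M [Mr bM]] := bf.
  by exists (M + 1) => x; apply: bM => //; rewrite ltrDl.
have [M bM] := bf; exists `|M|; split=> [|N MN x _]; first exact: normr_real.
have M0 : 0 <= M by apply: le_trans (bM x).
by apply: le_trans (bM x) _; rewrite -(ger0_norm M0) ltW.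
Qed.

Lemma bcont_subring : subring_closed bcont.
Proof.
split; first by apply/bcontP; split=> [x|]; [exact: cvg_cst|
  exists 1 => x; rewrite normr1].
- move=> f g /bcontP[cf [M fM]] /bcontP[cg [N gN]]; apply/bcontP; split.
    by move=> x; apply: cvgB; [exact: cf|exact: cg].
  by exists (M + N) => x; rewrite (le_trans (ler_normB _ _)) ?lerD.
- move=> f g /bcontP[cf [M fM]] /bcontP[cg [N gN]]; apply/bcontP; split.
    by move=> x; apply: cvgM; [exact: cf|exact: cg].
  by exists (M * N) => x; rewrite normrM ler_pM.
Qed.

Lemma bcont_submod : subsemimod_closed bcont.
Proof.
split.
  split; first by apply/bcontP; split=> [x|]; [exact: cvg_cst|
    exists 0 => x; rewrite normr0].
  move=> f g /bcontP[cf [M fM]] /bcontP[cg [N gN]]; apply/bcontP; split.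
    by move=> x; apply: cvgD; [exact: cf|exact: cg].
  by exists (M + N) => x; rewrite (le_trans (ler_normD _ _)) ?lerD.
move=> a f /bcontP[cf [M fM]]; apply/bcontP; split.
  by move=> x; apply: cvgZr; exact: cf.
by exists (`|a| * M) => x; rewrite normrM ler_wpM2l.
Qed.

Record CB := MkCB { CB_fun :> X -> F; CB_bcont : CB_fun \in bcont }.

HB.instance Definition _ := [isSub for CB_fun].
HB.instance Definition _ := [Choice of CB by <:].
HB.instance Definition _ :=
  GRing.SubChoice_isSubComPzRing.Build (X -> F) bcont CB bcont_subring.
HB.instance Definition _ :=
  GRing.SubZmodule_isSubLmodule.Build F (X -> F) bcont CB bcont_submod.

Definition sup_norm (f : CB) : F := supremum 0 [set `|f x| | x in [set: X]].

Implicit Types f g : CB.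

Lemma sup_norm_ub f x : `|f x| <= sup_norm f.
Proof.
rewrite /sup_norm /supremum; case: ifPn => [/eqP/seteqP[+ _]|n0].
  by move=> /(_ `|f x|)[]; exists x.
case: xgetP => [y _ [+ _]|nos]; first by apply; exists x.
have [_ [M fM]] := elimT (bcontP _) (CB_bcont f).
have [||y /nos//] := @scalars_sup R k [set `|f x| | x in [set: X]].
- by move=> _ [z _ <-].
- by split; [exists `|f x|, x | exists M => _ [z _ <-]].
Qed.

Lemma sup_norm_le f M : 0 <= M -> (forall x, `|f x| <= M) -> sup_norm f <= M.
Proof.
move=> M0 fM; rewrite /sup_norm /supremum; case: ifPn => // n0.
by case: xgetP => [y _ [_ +]|//]; apply => _ [z _ <-].
Qed.

Lemma sup_norm_ge0 f : 0 <= sup_norm f.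
Proof.
have [[x _]|nX] := pselect (exists x : X, True).
  exact: le_trans (normr_ge0 _) (sup_norm_ub f x).
rewrite /sup_norm (_ : [set _ | _ in _] = set0) ?supremum0//.
by apply/seteqP; split=> // y [x]; case: nX; exists x.
Qed.

Lemma ler_sup_normD f g : sup_norm (f + g) <= sup_norm f + sup_norm g.
Proof.
apply: sup_norm_le => [|x]; first by rewrite addr_ge0 ?sup_norm_ge0.
by rewrite (le_trans (ler_normD _ _)) ?lerD ?sup_norm_ub.
Qed.

Lemma sup_normZ a f : sup_norm (a *: f) = `|a| * sup_norm f.
Proof.
apply/eqP; rewrite eq_le; apply/andP; split.
  apply: sup_norm_le => [|x]; first by rewrite mulr_ge0 ?sup_norm_ge0.
  by rewrite normrM ler_wpM2l ?sup_norm_ub.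
have [->|a0] := eqVneq a 0; first by rewrite normr0 mul0r sup_norm_ge0.
rewrite mulrC -ler_pdivlMr ?normr_gt0//; apply: sup_norm_le => [|x].
  by rewrite divr_ge0 ?sup_norm_ge0.
rewrite ler_pdivlMr ?normr_gt0// mulrC -normrM.
exact: (sup_norm_ub (a *: f)).
Qed.

Lemma sup_norm_eq0 f : sup_norm f = 0 -> f = 0.
Proof.
move=> f0; apply/val_inj/funext => x; apply/eqP.
by rewrite -normr_le0 -f0 sup_norm_ub.
Qed.

HB.instance Definition _ := Lmodule_isNormed.Build F CB
  ler_sup_normD sup_normZ sup_norm_eq0.

Lemma CB_normM f g : `|f * g| <= `|f| * `|g|.
Proof.
apply: sup_norm_le => [|x]; first by rewrite mulr_ge0 ?sup_norm_ge0.
by rewrite normrM ler_pM ?sup_norm_ub.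
Qed.

Implicit Types H K : set CB.

Definition ideal H := [/\ H 0, forall f g, H f -> H g -> H (f + g)
  & forall a f, H f -> H (a * f)].

Definition closed_ideal H := ideal H /\ closed H.

Definition non_vanishing H := forall x, exists2 h, H h & h x != 0.

Definition closed_subideal H K := closed_ideal K /\ K `<=` H.

Definition proper_closed_subideal H K := closed_subideal H K /\ K <> H.

Definition sum_ideals (D : set nat) (K : nat -> set CB) : set CB :=
  [set f | exists2 s : seq CB,
    (forall g, g \in s -> (\bigcup_(n in D) K n) g) & f = \sum_(g <- s) g].

End CB.

Section stone_cech.
Variables (X B : topologicalType) (e : X -> B).

Definition embedding :=
  injective e /\ forall U, open U <-> exists2 V, open V & U = e @^-1` V.

(* [B], with [X] included through [e], is the Stone-Cech compactification of
   [X], characterized by its universal property. *)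
Definition stone_cech := [/\ compact [set: B], hausdorff_space B,
  embedding, dense (range e)
  & forall (K : topologicalType) (g : X -> K),
      compact [set: K] -> hausdorff_space K -> continuous g ->
      exists2 gB : B -> K, continuous gB & forall x, gB (e x) = g x].

End stone_cech.

Section spectrum.
Variables (R : realType) (k : scalar_kind) (X B : topologicalType).
Variable e : X -> B.

(* The default value of [xget] is irrelevant when [e] is a Stone-Cech
   compactification: see [beta_extP] and [beta_ext_uniq] below. *)
Definition beta_ext (f : CB R k X) : B -> scalars R k :=
  xget (cst 0) [set g | continuous g /\ forall x, g (e x) = f x].

Definition coz (Y : Type) (f : Y -> scalars R k) := [set y | f y != 0].

Definition spectrum (H : set (CB R k X)) : set B :=
  \bigcup_(h in H) coz (beta_ext h).

End spectrum.

Lemma compact_sub (T : topologicalType) (A : set T) :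
  compact A -> compact [set: A].
Proof.
move=> cA F FF _.
have [|p [Ap clp]] := cA (set_val @ F) _.
  by apply: (@filterE _ F) => x; exact: set_valP.
pose q : A := exist _ p (mem_set Ap).
exists q; split=> // P Q FP [_ [[V oV <-] Vq] VQ].
have [_ [[x Px <-] Vx]] : (set_val @` P `&` V) !=set0.
  apply: (clp (set_val @` P) V).
    by apply: (@filterS _ F _ P) FP => x Px /=; exists x.
  by apply: open_nbhs_nbhs; split => //; rewrite /q set_valE in Vq.
by exists x; split=> //; apply: VQ.
Qed.

Lemma hausdorff_sub (T : topologicalType) (A : set T) :
  hausdorff_space T -> hausdorff_space A.
Proof.
move=> hT x y clxy; apply/val_inj/hT => P Q Px Qy.
have [z [Pz Qz]] := clxy (set_val @^-1` P) (set_val @^-1` Q)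
  (@initial_continuous _ _ (set_val : A -> T) x P Px)
  (@initial_continuous _ _ (set_val : A -> T) y Q Qy).
by exists (set_val z).
Qed.

Lemma normcR (R : realType) (r : R) : `|r%:C%C : R[i]| = (`|r|)%:C%C.
Proof. by rewrite normc_def /= expr0n /= addr0 sqrtr_sqr. Qed.

Lemma normci1 (R : realType) : `|'i%C : R[i]| = 1.
Proof. by rewrite normc_def /= expr0n /= add0r expr1n sqrtr1. Qed.

Lemma normc_ge_Im (R : realType) (z : R[i]) : `|complex.Im z|%:C%C <= `|z|.
Proof.
by rewrite -normrN -ReiNIm (le_trans (normc_ge_Re _))// normrM normci1 mulr1.
Qed.

Section ext.
Variables (R : realType) (X B : topologicalType) (e : X -> B).
Hypothesis sc : stone_cech e.

Lemma real_ext (f : X -> R) (M : R) : continuous f -> (forall x, `|f x| <= M) ->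
  exists2 g : B -> R, continuous g & forall x, g (e x) = f x.
Proof.
move=> cf fM; have [_ _ _ _ univ] := sc.
pose K := `[- M, M]%classic : set R.
have fK x : f x \in K by rewrite inE /K /= in_itv /= -ler_norml.
pose g x : K := exist _ (f x) (fK x).
have [|||gB cgB gBe] := univ K g.
- exact/compact_sub/segment_compact.
- exact/hausdorff_sub/Rhausdorff.
- move=> x; apply/continuousP: x => A [V oV <-].
  by rewrite -comp_preimage; move/continuousP: cf; apply.
exists (set_val \o gB) => [y|x /=]; last by rewrite gBe.
apply: continuous_comp; first exact: cgB.
exact: initial_continuous.
Qed.

Lemma beta_ext_uniq k (f : CB R k X) (g h : B -> scalars R k) :
  continuous g -> continuous h ->
  (forall x, g (e x) = f x) -> (forall x, h (e x) = f x) -> g = h.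
Proof.
have [_ _ _ de _] := sc.
move=> cg ch gf hf; apply/funext => y; apply: contrapT => /eqP.
rewrite -subr_eq0 => gh.
have : open [set y | g y - h y != 0].
  have /continuousP c : continuous (fun y => g y - h y).
    by move=> z; apply: cvgB; [exact: cg|exact: ch].
  apply: (c [set z | z != 0]).
  rewrite (_ : [set z | _] = ~` [set 0]).
    apply/closed_openC/accessible_closed_set1/hausdorff_accessible.
    exact: norm_hausdorff.
  by apply/seteqP; split=> z /= /eqP.
move=> o.
have [|z [/= zz [x _ exz]]] := de _ _ o; first by exists y.
by move: zz; rewrite -exz gf hf subrr eqxx.
Qed.


Lemma beta_extP k (f : CB R k X) :
  continuous (beta_ext e f) /\ forall x, beta_ext e f (e x) = f x.
Proof.
rewrite /beta_ext; case: xgetP => [g _ //|nog]; exfalso.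
have [cf [M fM]] := elimT (bcontP _) (CB_bcont f).
case: k f nog cf M fM => f nog cf M fM.
  have [g cg gf] := @real_ext f M cf fM; exact: (nog g).
pose C : numFieldType := R[i].
have Rec : continuous (fun z : C => complex.Re (z : R[i])).
  move=> z A /nbhs_ballP[r /= r0 rA]; apply/nbhs_ballP.
  exists (r%:C%C) => /=; first by rewrite ltcR.
  move=> w /= zw; apply: rA; rewrite /ball /=.
  rewrite -raddfB /= -ltcR; apply: le_lt_trans zw.
  exact: normc_ge_Re.
have Imc : continuous (fun z : C => complex.Im (z : R[i])).
  move=> z A /nbhs_ballP[r /= r0 rA]; apply/nbhs_ballP.
  exists (r%:C%C) => /=; first by rewrite ltcR.
  move=> w /= zw; apply: rA; rewrite /ball /=.
  rewrite -raddfB /= -ltcR; apply: le_lt_trans zw.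
  exact: normc_ge_Im.
have rcc : continuous ((fun r => r%:C%C) : R -> C).
  move=> z A /nbhs_ballP[r /= r0 rA]; apply/nbhs_ballP.
  exists (complex.Re r) => /=.
    by move: r0; rewrite ltcE /= => /andP[].
  move=> w /= zw; apply: rA; rewrite /ball /= -raddfB /= normcR.
  by move: r0; rewrite ltcE /= => /andP[/eqP r0 _]; rewrite ltcE /= r0 eqxx.
have [a ca af] : exists2 a : B -> R, continuous a &
    forall x, a (e x) = complex.Re (f x : R[i]).
  apply: (@real_ext _ (complex.Re (M : R[i]))) => x.
    by apply: (@continuous_comp _ C _ f); [exact: cf|exact: Rec].
  by have := le_trans (normc_ge_Re _) (fM x); rewrite lecE => /andP[_].
have [b cb bf] : exists2 b : B -> R, continuous b &
    forall x, b (e x) = complex.Im (f x : R[i]).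
  apply: (@real_ext _ (complex.Re (M : R[i]))) => x.
    by apply: (@continuous_comp _ C _ f); [exact: cf|exact: Imc].
  by have := le_trans (normc_ge_Im _) (fM x); rewrite lecE => /andP[_].
apply: (nog (fun y => ((a y)%:C%C : C) + 'i%C * ((b y)%:C%C : C))).
split=> [y|x]; last by rewrite af bf -complexE.
apply: (@cvgD C); first by
  apply: (@continuous_comp _ R C a); [exact: ca|exact: rcc].
apply: (@cvgM C); first exact: cvg_cst.
by apply: (@continuous_comp _ R C b); [exact: cb|exact: rcc].
Qed.
End ext.

(* For a subset [A] of a space, [countably_compact A] refers to [A] as a type
   with the subspace topology. *)
Definition countably_compact (T : topologicalType) :=
  hausdorff_space T /\
  forall (I : choiceType) (D : set I) (U : I -> set T),
    countable D -> (forall i, D i -> open (U i)) -> [set: T] `<=` cover D U ->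
    finite_subset_cover D U [set: T].

(* Main.v *)
Require Import Defs.
From HB Require Import structures.
From mathcomp Require Import all_boot all_order all_algebra.
From mathcomp Require Import complex finmap.
From mathcomp Require Import all_classical all_reals.
From mathcomp Require Import topology normedtype.

Import Order.TTheory GRing.Theory Num.Theory.
Import numFieldNormedType.Exports.

Local Open Scope classical_set_scope.
Local Open Scope ring_scope.

(** The theorem rests on the correspondence between the closed ideals of
C_B(X) and the open subsets of the Stone-Cech compactification [B] of [X].

An ideal [J] has the open set [spectrum e J], which taking the closure of [J]
does not enlarge ([spectrum_closure]) and which, for a sum of ideals, is covered
by the spectra of the summands ([spectrum_sum_ideals]).  An open set [W] has the
closed ideal [supported_in W] of the functions whose extension to [B] vanishes
off [W].  The ideal can be recovered from its spectrum: if the cozero set of the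
extension of [f] lies in [spectrum e J], then [f] is in the closure of [J]
([coz_sub_closure]).  Indeed, given a threshold [d > 0], the set where
[d <= |f|] on [B] is compact, so some nonnegative [u] in [J] exceeds 1 on it,
and [f] is uniformly within [d] of the member [f * (t u / (1 + t u))] of [J] as
soon as [t] is large.

(1) -> (2): if [H] is the closed sum of the [K n], the spectra of the [K n]
form a countable open cover of the spectrum of [H].  Finitely many suffice, and
[coz_sub_closure] turns this back into a statement on the partial sum.

(2) -> (3): if the union of an increasing sequence is dense in [H], so is the sum,
hence some partial sum; but the sum of [K 0, ..., K m] lies in the closed ideal
[K m], which is proper.

(3) -> (1): suppose that a countable open cover of the spectrum of [H] has no
finite subcover, and let [W n] be the union of its first members.  The ideals
[H `&` supported_in (W n)] are closed, increasing, and proper since no [W n]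
contains the spectrum.  By Urysohn's lemma on [B], the spectrum of their
union is still that of [H], so the union is dense in [H], contradicting (3). *)

(** * Compactness and scalar functions *)

(** A property of sets that is local, hereditary and stable under binary unions
holds for compact sets: otherwise the complements in [C] of the sets with the
property generate a proper filter, and the property would fail near any cluster
point of that filter. *)
Lemma compact_ind (T : topologicalType) (C : set T) (P : set T -> Prop) :
  compact C -> P set0 ->
  (forall U V, U `<=` V -> P V -> P U) ->
  (forall U V, P U -> P V -> P (U `|` V)) ->
  (forall y, C y -> exists2 V, nbhs y V & P V) -> P C.
Proof.
move=> cC P0 Psub PU Ploc; apply: contrapT => nPC.
pose G : set_system T := [set A | P (C `\` A)].
have FG : ProperFilter G.
  apply: Build_ProperFilter_ex.
    move=> A GA; apply: contrapT => nA; apply: nPC; apply: Psub GA => y Cy.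
    by split=> // Ay; apply: nA; exists y.
  split.
  - by rewrite /G /= setDT.
  - by move=> A A' GA GA'; rewrite /G /= setDIr; exact: PU.
  - by move=> A A' sA; apply: Psub => y [Cy nA']; split=> // /sA.
have [|y [Cy cly]] := cC G FG; first by rewrite /G /= setDv.
have [V yV PV] := Ploc y Cy.
have [|z [nVz Vz]] := cly (~` V) V _ yV; last exact: nVz.
by rewrite /G /=; apply: Psub PV => z [_ /contrapT].
Qed.

Section scalar_functions.
Context {F : numFieldType} {T : topologicalType}.

Lemma norm_gt_near (g : T -> F) (c : F) y : continuous g -> 0 <= c ->
  c < `|g y| -> \forall z \near y, c < `|g z|.
Proof.
move=> cg c0 cy.
have d0 : 0 < `|g y| - c by rewrite subr_gt0.
have : \forall z \near y, ball (g y) (`|g y| - c) (g z).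
  exact: cg y _ (nbhsx_ballx _ _ d0).
apply: filterS => z /= d.
have := lerB_dist (g y) (g z).
by move=> /le_lt_trans /(_ d); rewrite ltrD2l ltrN2.
Qed.

Lemma open_neq0 (g : T -> F) : continuous g -> open [set y | g y != 0].
Proof.
move=> cg; rewrite openE => y gy.
have : 0 < `|g y| by rewrite normr_gt0.
move=> /(@norm_gt_near g 0 y cg (lexx 0)); apply: filterS => z.
by rewrite normr_gt0.
Qed.

(** This is complex conjugation, in a form that makes sense uniformly over the
real and the complex scalars; at [0] it takes the value [0] since [0^-1 = 0]. *)
Definition sconj (z : F) : F := `|z| ^+ 2 / z.

Lemma norm_sconj z : `|sconj z| = `|z|.
Proof.
rewrite /sconj normrM normfV ger0_norm ?exprn_ge0//.
have [->|z0] := eqVneq z 0; first by rewrite normr0 expr0n mul0r.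
by rewrite expr2 mulfK// normr_eq0.
Qed.

Lemma sconjM z : sconj z * z = `|z| ^+ 2.
Proof.
have [->|z0] := eqVneq z 0; first by rewrite normr0 expr0n mulr0.
by rewrite /sconj divfK.
Qed.

Lemma sconj_continuous : continuous sconj.
Proof.
(* At 0 the quotient is not continuous termwise, but sconj preserves norms. *)
move=> z; have [->|z0] := eqVneq z 0.
  move=> A /nbhs_ballP[r /= r0 rA]; apply/nbhs_ballP.
  have a0 : sconj 0 = 0 by rewrite /sconj invr0 mulr0.
  exists r => // w /= zw; apply: rA; move: zw.
  by rewrite a0 /ball /= !sub0r !normrN norm_sconj.
have -> : sconj = (fun w => `|w| * `|w| * w^-1).
  by apply/funext => w; rewrite /sconj expr2.
have cn : (fun w : F => `|w|) @ z --> `|z| by exact: norm_continuous.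
apply: (cvgM (f := fun w => `|w| * `|w|) (cvgM cn cn)).
exact: inv_continuous.
Qed.

End scalar_functions.

(** * Ideals of bounded continuous functions *)

Section scalar_CB.
Context {R : realType} {k : scalar_kind} {X : topologicalType}.
Local Notation F := (scalars R k).
Implicit Types (f g h u : CB R k X) (J K : set (CB R k X)).

Lemma CB_continuous f : continuous f.
Proof. by have [] := elimT (bcontP _) (CB_bcont f). Qed.

Lemma CB_mk (p : X -> F) (M : F) : continuous p -> (forall x, `|p x| <= M) ->
  exists f, forall x, f x = p x.
Proof.
move=> cp bp; have pb : p \in @bcont R k X.
  by apply/bcontP; split=> //; exists M.
by exists (MkCB pb).
Qed.

(** Multiplying by the conjugate, which is again bounded and continuous, stays in
the ideal; for [t > 0] it gives a nonnegative function with the zeros of [h]. *)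
Lemma ideal_sqr J h (t : F) : ideal J -> J h ->
  exists2 u, J u & forall x, u x = t * `|h x| ^+ 2.
Proof.
move=> [_ _ JM] Jh.
have [|x|c cE] := @CB_mk (fun x => t * sconj (h x)) (`|t| * `|h|).
- move=> x; apply: cvgM; first exact: cvg_cst.
  by apply: continuous_comp; [exact: CB_continuous|exact: sconj_continuous].
- by rewrite normrM norm_sconj ler_wpM2l// sup_norm_ub.
- exists (c * h) => [|x]; first exact: JM.
  by rewrite -sconjM mulrA -cE.
Qed.

Lemma closureCBP J f :
  closure J f <-> forall d : F, 0 < d -> exists2 j, J j & `|f - j| < d.
Proof.
split=> [clf d d0|clf A /nbhs_ballP[d /= d0 dA]].
  have [j [Jj fj]] := clf _ (nbhsx_ballx f _ d0).
  by exists j => //; move: fj; rewrite -ball_normE.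
have [j Jj fj] := clf d d0; exists j; split=> //; apply: dA.
by rewrite -ball_normE.
Qed.

(** The approximant is [f * (t u / (1 + t u))] with [t = |f| / d]: the error
[f / (1 + t u)] is at most [|f x|] everywhere, which settles the points where
[|f x| < d]; at the others [1 < u x] and it is at most [|f| / (1 + t) <= d]. *)
Lemma CB_approx f u (J : set (CB R k X)) (d : F) : 0 < d -> ideal J -> J u ->
  (forall x, 0 <= u x) -> (forall x, d <= `|f x| -> 1 < u x) ->
  exists2 j, J j & `|f - j| <= d.
Proof.
move=> d0 [_ _ JM] Ju u0 u1.
pose t := `|f| / d.
have t0 : 0 <= t by rewrite divr_ge0 ?normr_ge0 ?ltW.
have p1 x : 1 <= 1 + t * u x by rewrite lerDl mulr_ge0.
have p0 x : 0 < 1 + t * u x by apply: lt_le_trans (p1 x).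
have [|x|v vE] := @CB_mk (fun x => t / (1 + t * u x)) t.
- move=> x; apply: cvgM; first exact: cvg_cst.
  apply: cvgV; first by rewrite gt_eqF.
  apply: cvgD; first exact: cvg_cst.
  by apply: cvgM; [exact: cvg_cst|exact: CB_continuous].
- rewrite ger0_norm ?(divr_ge0 t0) ?(ltW (p0 x))//.
  by rewrite ler_pdivrMr// ler_peMr.
exists (f * v * u); first exact: JM.
apply: sup_norm_le => [|x]; first exact: ltW.
have -> : (f - f * v * u) x = f x / (1 + t * u x).
  have -> : (f - f * v * u) x = f x - f x * v x * u x by [].
  have n0 : 1 + t * u x != 0 by rewrite gt_eqF.
  apply: (canRL (mulfK n0)).
  by rewrite vE mulrBl (mulrAC _ (u x)) !mulrA divfK// mulrDr mulr1 !mulrA addrK.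
rewrite normrM normfV (gtr0_norm (p0 x)) ler_pdivrMr//.
have [fd|df] := real_ltP (normr_real (f x)) (gtr0_real d0).
  by rewrite (le_trans (ltW fd))// ler_peMr ?(ltW d0)// p1.
rewrite mulrDr mulr1 mulrA (mulrC d) divfK ?gt_eqF//.
rewrite (le_trans (sup_norm_ub f x))// (@le_trans _ _ (`|f| * u x))//.
  by apply: ler_peMr; [exact: sup_norm_ge0|exact/ltW/u1].
by rewrite lerDr ltW.
Qed.

Lemma closed_ideal_setI J K : closed_ideal J -> closed_ideal K ->
  closed_ideal (J `&` K).
Proof.
move=> [[J0 JD JM] cJ] [[K0 KD KM] cK]; split; last exact: closedI.
split=> // [f g [Jf Kf] [Jg Kg]|a f [Jf Kf]].
  by split; [exact: JD|exact: KD].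
by split; [exact: JM|exact: KM].
Qed.

Lemma ideal_sum J (s : seq (CB R k X)) : ideal J ->
  (forall g, g \in s -> J g) -> J (\sum_(g <- s) g).
Proof.
move=> [J0 JD _]; elim: s => [|g s IH] Js; first by rewrite big_nil.
rewrite big_cons; apply: JD; first by apply: Js; rewrite mem_head.
by apply: IH => g' g's; apply: Js; rewrite in_cons g's orbT.
Qed.

Lemma sum_ideals_ideal (D : set nat) (K : nat -> set (CB R k X)) :
  (forall n, ideal (K n)) -> ideal (sum_ideals D K).
Proof.
move=> Ki; split.
- by exists [::] => //; rewrite big_nil.
- move=> _ _ [s sK ->] [s' s'K ->]; exists (s ++ s'); last by rewrite big_cat.
  by move=> g; rewrite mem_cat => /orP[/sK|/s'K].
- move=> a _ [s sK ->]; exists [seq a * g | g <- s].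
    move=> _ /mapP[g /sK[n Dn Kg] ->]; exists n => //.
    by have [_ _] := Ki n; apply.
  by rewrite big_map mulr_sumr.
Qed.

Lemma bigcup_sum_ideals (D : set nat) (K : nat -> set (CB R k X)) :
  \bigcup_(n in D) K n `<=` sum_ideals D K.
Proof.
move=> f Kf; exists [:: f]; last by rewrite big_seq1.
by move=> g; rewrite inE => /eqP ->.
Qed.

Lemma sum_ideals_sub (D : set nat) (K : nat -> set (CB R k X)) J : ideal J ->
  (forall n, D n -> K n `<=` J) -> sum_ideals D K `<=` J.
Proof.
move=> iJ KJ _ [s sK ->]; apply: ideal_sum => // g /sK[n Dn].
exact: KJ.
Qed.

Lemma closure_sub_closed J K : closed K -> J `<=` K -> closure J `<=` K.
Proof. by move=> cK JK; rewrite closureE => f; apply; split. Qed.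

Lemma scalar_embedding : exists iota : R -> F,
  [/\ continuous iota, iota 0 = 0, iota 1 = 1 &
      forall r, `|r| <= 1 -> `|iota r| <= 1].
Proof.
case: k; first by exists id; split=> // r; apply: cvg_id.
exists (fun r => r%:C%C : scalars R ComplexScalars); split=> //.
  move=> z A /nbhs_ballP[r /= r0 rA]; apply/nbhs_ballP.
  move: r0; rewrite ltcE /= => /andP[/eqP ri r0].
  exists (complex.Re r) => // w /= zw; apply: rA; rewrite /ball /=.
  by rewrite -raddfB /= normcR ltcE /= ri eqxx.
by move=> r r1; rewrite normcR lecE /= eqxx.
Qed.

End scalar_CB.

(** * Ideals and open sets of the Stone-Cech compactification *)

Section beta.
Context {R : realType} {k : scalar_kind} {X B : topologicalType} {e : X -> B}.
Hypothesis sc : stone_cech e.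
Local Notation F := (scalars R k).
Local Notation "f ^b" := (beta_ext e f) (at level 2, format "f ^b").
Implicit Types (f g h u : CB R k X) (J K H : set (CB R k X)).

Lemma beta_ext_continuous f : continuous f^b.
Proof. by have [] := beta_extP sc f. Qed.

Lemma beta_extE f x : f^b (e x) = f x.
Proof. by have [_ ->] := beta_extP sc f. Qed.

Lemma beta_extD f g y : (f + g)^b y = f^b y + g^b y.
Proof.
suff -> : (f + g)^b = (fun y => f^b y + g^b y) by [].
apply: (beta_ext_uniq sc (f := f + g)); first exact: beta_ext_continuous.
- by move=> z; apply: cvgD; exact: beta_ext_continuous.
- exact: beta_extE.
- by move=> x; rewrite !beta_extE.
Qed.

Lemma beta_extM f g y : (f * g)^b y = f^b y * g^b y.
Proof.
suff -> : (f * g)^b = (fun y => f^b y * g^b y) by [].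
apply: (beta_ext_uniq sc (f := f * g)); first exact: beta_ext_continuous.
- by move=> z; apply: cvgM; exact: beta_ext_continuous.
- exact: beta_extE.
- by move=> x; rewrite !beta_extE.
Qed.

Lemma beta_ext0 y : (0 : CB R k X)^b y = 0.
Proof.
suff -> : (0 : CB R k X)^b = (fun=> 0) by [].
apply: (beta_ext_uniq sc (f := 0)); first exact: beta_ext_continuous.
- by move=> z; exact: cvg_cst.
- exact: beta_extE.
- by [].
Qed.

(** By density of [X]: a value of larger norm would persist near [y]. *)
Lemma beta_ext_le f y : `|f^b y| <= `|f|.
Proof.
rewrite real_leNgt ?normr_real//; apply/negP => fy.
have : nbhs y [set z | `|f| < `|f^b z|].
  exact: norm_gt_near (beta_ext_continuous f) (normr_ge0 _) fy.
rewrite nbhsE => -[V [oV Vy] VS].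
have [_ _ _ de _] := sc.
have [|z [Vz [x _ xz]]] := de V _ oV; first by exists y.
have := VS _ Vz; rewrite -xz /= beta_extE.
by rewrite real_ltNge ?normr_real// sup_norm_ub.
Qed.

Lemma spectrum_open J : open (spectrum e J).
Proof.
by apply: bigcup_open => h _; apply: open_neq0; exact: beta_ext_continuous.
Qed.

(** If [f] is closer to [j] than [|f y|], then [j] does not vanish at [y]
either. *)
Lemma spectrum_closure J : spectrum e (closure J) `<=` spectrum e J.
Proof.
move=> y [f /closureCBP Jf fy].
have [|j Jj fj] := Jf `|f^b y|; first by rewrite normr_gt0.
exists j => //; apply/eqP => jy.
have := beta_ext_le (f - j) y.
rewrite real_leNgt ?normr_real//; move/negP; apply; apply: lt_le_trans fj _.
by rewrite -[X in X^b](subrK j f) (beta_extD (f - j)) jy addr0.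
Qed.

Lemma spectrum_sum_ideals (D : set nat) (K : nat -> set (CB R k X)) :
  spectrum e (sum_ideals D K) `<=` \bigcup_(n in D) spectrum e (K n).
Proof.
move=> y [_ [s sK ->]]; rewrite /coz /=.
elim: s sK => [|g s IH] sK; first by rewrite big_nil beta_ext0 eqxx.
rewrite big_cons beta_extD.
have [->|gy _] := eqVneq (g^b y) 0.
  rewrite add0r; apply: IH => g' g's; apply: sK.
  by rewrite in_cons g's orbT.
have [|n Dn Kg] := sK g; first by rewrite mem_head.
by exists n => //; exists g.
Qed.

(** Requiring [1 < u] rather than [u != 0] gives the local functions, which
come from rescaled squares, a bound that survives addition, so that
[compact_ind] applies.  The inequalities are stated on [X] only, through [e]. *)
Lemma ideal_gt1_compact J (C : set B) : ideal J -> compact C ->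
  C `<=` spectrum e J ->
  exists u, [/\ J u, forall x, 0 <= u x & forall x, C (e x) -> 1 < u x].
Proof.
move=> iJ cC CJ; have [J0 JD JM] := iJ.
apply: (@compact_ind _ C (fun V => exists u,
  [/\ J u, forall x, 0 <= u x & forall x, V (e x) -> 1 < u x])) => //.
- by exists 0; split.
- by move=> U V UV [u [Ju u0 u1]]; exists u; split=> // x /UV; exact: u1.
- move=> U V [u [Ju u0 u1]] [v [Jv v0 v1]]; exists (u + v); split=> [|x|x].
  + exact: JD.
  + exact: (addr_ge0 (u0 x) (v0 x)).
  + have -> : (u + v) x = u x + v x by [].
    case=> [/u1|/v1] w1; apply: lt_le_trans w1 _.
      by rewrite lerDl.
    by rewrite lerDr.
- move=> y /CJ[h Jh hy].
  pose c := `|h^b y| / 2.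
  have hy0 : 0 < `|h^b y| by rewrite normr_gt0.
  have c0 : 0 < c by rewrite divr_gt0.
  have [u Ju uE] := ideal_sqr J h (c ^- 2) iJ Jh.
  exists [set z | c < `|h^b z|].
    apply: norm_gt_near; [exact: beta_ext_continuous|exact: ltW|].
    by rewrite /c ltr_pdivrMr// ltr_pMr// ltr1n.
  exists u; split=> [//|x|x /=].
    by rewrite uE mulr_ge0 ?invr_ge0 ?exprn_ge0 ?(ltW c0).
  rewrite uE beta_extE => ch; rewrite mulrC ltr_pdivlMr ?exprn_gt0// mul1r.
  by rewrite ltrXn2r// ?nnegrE ltW.
Qed.

(** The step that recovers a closed ideal from its spectrum: the set where
[d / 2 <= |f|] is compact and contained in the spectrum, which is what
[CB_approx] needs. *)
Lemma coz_sub_closure J f : ideal J -> coz f^b `<=` spectrum e J -> closure J f.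
Proof.
move=> iJ fJ; apply/closureCBP => d d0.
have d20 : 0 < d / 2 by rewrite divr_gt0.
pose C := [set y | d / 2 <= `|f^b y|].
have cC : compact C.
  have [cB _ _ _ _] := sc.
  apply: (subclosed_compact _ cB) => //.
  have -> : C = ~` (f^b @^-1` ball 0 (d / 2)).
    apply/seteqP; split=> y; rewrite /C /= /ball /= sub0r normrN.
      by move=> dy /(le_lt_trans dy); rewrite ltxx.
    by rewrite real_leNgt ?(gtr0_real d20) ?normr_real// => /negP.
  apply: open_closedC; apply: open_comp; last exact: ball_open.
  by move=> y _; exact: beta_ext_continuous.
have [|u [Ju u0 u1]] := ideal_gt1_compact J C iJ cC.
  move=> y dy; apply: fJ; rewrite /coz /= -normr_gt0.
  exact: lt_le_trans dy.
have [|j Jj fj] := CB_approx f u J (d / 2) d20 iJ Ju u0.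
  by move=> x fx; apply: u1; rewrite /C /= beta_extE.
exists j => //; apply: le_lt_trans fj _.
by rewrite ltr_pdivrMr// ltr_pMr// ltr1n.
Qed.

Definition supported_in (W : set B) : set (CB R k X) :=
  [set f | coz f^b `<=` W].

Lemma supported_in_closed_ideal W : closed_ideal (supported_in W).
Proof.
have iW : ideal (supported_in W).
  split.
  - by move=> y; rewrite /coz /= beta_ext0 eqxx.
  - move=> f g fW gW y; rewrite /coz /= beta_extD.
    have [fy|fy _] := eqVneq (f^b y) 0; last exact: fW.
    by rewrite fy add0r => /gW.
  - move=> a f fW y; rewrite /coz /= beta_extM mulf_eq0 negb_or.
    by move=> /andP[_ /fW].
split=> // f clf y fy.
have [|j jW jy] := spectrum_closure (supported_in W) y; first by exists f.
exact: jW.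
Qed.

(** Urysohn's lemma on the compact Hausdorff space [B], transferred to C_B(X)
by restriction along [e]; the extension of the restriction is the original
function. *)
Lemma supported_in_separates (W : set B) y : open W -> W y ->
  exists2 g, supported_in W g & g^b y != 0.
Proof.
move=> oW Wy; have [cB hB [_ eop] _ _] := sc.
have ce : continuous e.
  by apply/continuousP => A oA; apply/eop; exists A.
have sepW : uniform_separator [set y] (~` W).
  apply: (@normal_completely_regular R B) => [|||/(_ Wy)//].
  - exact: compact_normal.
  - exact: hausdorff_accessible.
  - exact: open_closedC.
have /(@uniform_separatorP _ R)[p [cp p01 py pW]] := sepW.
have [iota [ci i0 i1 ib]] := @scalar_embedding R k.
pose q z := iota (1 - p z).
have cq : continuous q.
  move=> z; apply: (@continuous_comp _ _ _ (fun z => 1 - p z)); last exact: ci.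
  by apply: cvgB; [exact: cvg_cst|exact: cp].
have [|x|g gE] := @CB_mk R k X (q \o e) 1.
- by move=> x; apply: continuous_comp; [exact: ce|exact: cq].
- apply: ib.
  have : `[0, 1]%classic (p (e x)) by apply: p01; exists (e x).
  rewrite /= in_itv /= => /andP[a b].
  by rewrite ger0_norm ?subr_ge0// gerBl.
have gq : g^b = q.
  apply: (beta_ext_uniq sc (f := g)) => //; first exact: beta_ext_continuous.
  exact: beta_extE.
exists g; last first.
  by rewrite gq /q (py (p y)) ?subr0 ?i1 ?oner_neq0//; exists y.
move=> z; rewrite /coz /= gq => /eqP qz; apply: contrapT => nWz; apply: qz.
by rewrite /q (pW (p z)) ?subrr ?i0//; exists z.
Qed.

(** * The three implications *)

(** The spectra of the summands cover the spectrum of [H]; a finite subcover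
gives the partial sum. *)
Lemma countably_compact_finite_sum H : closed_ideal H ->
  countably_compact (spectrum e H) ->
  forall K : nat -> set (CB R k X), (forall n, closed_subideal H (K n)) ->
  H = closure (sum_ideals setT K) ->
  exists2 m, (0 < m)%N & H = closure (sum_ideals `I_m K).
Proof.
move=> [iH cH] [_ cc] K KH HK.
have Ki n : ideal (K n) by have [[]] := KH n.
have [|n _||D' _ covD'] := cc nat setT (fun n => set_val @^-1` spectrum e (K n)).
+ exact: countableP.
+ by exists (spectrum e (K n)) => //; exact: spectrum_open.
+ move=> y _; have [h Hh hy] : spectrum e H (set_val y) by exact: set_valP.
  apply/spectrum_sum_ideals/spectrum_closure.
  by exists h => //; rewrite -HK.
have [m D'm] : exists m, forall i, i \in D' -> (i < m)%N.
  exists (\max_(i <- D') i).+1 => i iD'.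
  by rewrite ltnS; apply: (leq_bigmax_seq (F := id) i).
exists m.+1 => //; apply/seteqP; split; last first.
  apply: closure_sub_closed => //; apply: sum_ideals_sub => // n _.
  by have [] := KH n.
move=> h Hh; apply: coz_sub_closure.
  exact: sum_ideals_ideal.
move=> y hy.
have Hy : y \in spectrum e H by rewrite inE; exists h.
have [i /= iD' [g Kg gy]] := covD' (exist _ y Hy) I.
exists g => //; apply: bigcup_sum_ideals; exists i => //=.
by rewrite ltnS ltnW// D'm.
Qed.

(** Urysohn's lemma enters here: at a point of the spectrum of [H] lying in some
[W n], multiplying a member of [H] by a separating function gives a member of
[K n] that still does not vanish there. *)
Lemma proper_chains_countably_compact H : closed_ideal H ->
  (forall K : nat -> set (CB R k X),
    (forall n, proper_closed_subideal H (K n)) ->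
    (forall n, K n `<=` K n.+1) -> H <> closure (\bigcup_n K n)) ->
  countably_compact (spectrum e H).
Proof.
move=> [iH cH] H3; have [_ hB _ _ _] := sc; split; first exact: hausdorff_sub.
move=> I D U /countable_injP[c cinj] oU covU.
apply: contrapT => nfin.
have [V VU] : {V : I -> set B & forall i, D i ->
    open (V i) /\ U i = set_val @^-1` V i}.
  apply: (@choice _ _ (fun i V => D i -> open V /\ U i = set_val @^-1` V)).
  move=> i; have [Di|nDi] := pselect (D i); last by exists set0.
  by have [V oV VE] := oU i Di; exists V.
(* [c] numbers the cover injectively, so each [A n] is finite. *)
pose A n := D `&` [set i | (c i <= n)%N].
pose W n := \bigcup_(i in A n) V i.
have finA n : finite_set (A n).
  have cA : {in A n &, injective c}.
    by move=> i j /[!inE] -[Di _] [Dj _]; apply: cinj; rewrite inE.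
  rewrite -(eq_finite_set (inj_card_eq cA)).
  apply: (sub_finite_set _ (finite_II n.+1)).
  by move=> _ [i [_ cin] <-].
have oW n : open (W n).
  by apply: bigcup_open => i [/VU[]].
pose K n := H `&` supported_in (W n).
have Kcl n : closed_ideal (K n).
  exact: closed_ideal_setI (supported_in_closed_ideal _).
have KS n : K n `<=` K n.+1.
  move=> f [Hf fW]; split=> // y /fW[i [Di cin] Viy]; exists i => //.
  by split=> //=; exact: leqW.
have KH n : proper_closed_subideal H (K n).
  split; first by split=> // f [].
  move=> KE; apply: nfin.
  exists (fset_set (A n)) => [i|y _].
    by rewrite in_fset_set// !inE => -[].
  have [h Hh hy] : spectrum e H (set_val y) by exact: set_valP.
  have : K n h by rewrite KE.
  move=> [_ /(_ _ hy)[i Ai Viy]]; exists i.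
    by rewrite /= in_fset_set// inE.
  by have [_ ->] := VU i Ai.1.
apply: (H3 K KH KS); apply/seteqP; split; last first.
  by apply: closure_sub_closed => // f [n _ []].
have Kmono m n : (m <= n)%N -> K m `<=` K n.
  exact: (homo_leq (@subset_refl _) (fun A B C => @subset_trans _ A B C) KS).
have iUK : ideal (\bigcup_n K n).
  split.
  + by exists 0%N => //; have [[]] := Kcl 0%N.
  + move=> f g [m _ Kf] [n _ Kg]; exists (maxn m n) => //.
    have [[_ KD _] _] := Kcl (maxn m n).
    apply: KD; [move: Kf|move: Kg]; apply: Kmono.
      exact: leq_maxl.
    exact: leq_maxr.
  + move=> a f [n _ Kf]; exists n => //.
    by have [[_ _ KM] _] := Kcl n; exact: KM.
move=> h Hh; apply: coz_sub_closure => // y hy.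
have Hy : y \in spectrum e H by rewrite inE; exists h.
have [i Di Uiy] := covU (exist _ y Hy) Logic.I.
have [oV VE] := VU i Di.
have Wy : W (c i) y.
  by exists i; [split=> /=|rewrite VE in Uiy].
have [g gW gy] := supported_in_separates _ _ (oW (c i)) Wy.
exists (g * h); last first.
  by rewrite /coz /= beta_extM mulf_neq0.
exists (c i) => //; split; first by have [_ _ HM] := iH; exact: HM.
move=> z; rewrite /coz /= beta_extM mulf_eq0 negb_or.
by move=> /andP[/gW].
Qed.

End beta.

(** For an increasing sequence, the partial sums are the terms themselves. *)
Lemma finite_sum_proper_chains (R : realType) (k : scalar_kind)
  (X : topologicalType) (H : set (CB R k X)) : closed_ideal H ->
  (forall K : nat -> set (CB R k X), (forall n, closed_subideal H (K n)) ->
    H = closure (sum_ideals setT K) ->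
    exists2 m, (0 < m)%N & H = closure (sum_ideals `I_m K)) ->
  forall K : nat -> set (CB R k X),
  (forall n, proper_closed_subideal H (K n)) ->
  (forall n, K n `<=` K n.+1) -> H <> closure (\bigcup_n K n).
Proof.
move=> [iH cH] H2 K KH KS HK.
have KHS n : K n `<=` H by have [[]] := KH n.
have Kmono m n : (m <= n)%N -> K m `<=` K n.
  exact: (homo_leq (@subset_refl _) (fun A B C => @subset_trans _ A B C) KS).
have [n||[//|m] _ Hm] := H2 K.
+ by have [] := KH n.
+ apply/seteqP; split.
    by rewrite {1}HK; apply: closure_subset; exact: bigcup_sum_ideals.
  by apply: closure_sub_closed => //; apply: sum_ideals_sub.
have [[[iK cK] _] KnH] := KH m; apply: KnH; apply/seteqP; split=> //.
rewrite Hm; apply: closure_sub_closed => //; apply: sum_ideals_sub => // n /=.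
by rewrite ltnS; exact: Kmono.
Qed.

Theorem theorem3p9 (R : realType) (k : scalar_kind)
  (X : topologicalType)
  (X_creg : completely_regular_space X) (X_haus : hausdorff_space X)
  (bX : topologicalType) (e : X -> bX) (bX_sc : stone_cech e)
  (H : set (CB R k X))
  (H_ideal : closed_ideal H) (H_nv : non_vanishing H) :
  [<-> (*1*) countably_compact (spectrum e H);
       (*2*) forall K : nat -> set (CB R k X),
               (forall n, closed_subideal H (K n)) ->
               H = closure (sum_ideals setT K) ->
               exists2 m, (0 < m)%N & H = closure (sum_ideals `I_m K);
       (*3*) forall K : nat -> set (CB R k X),
               (forall n, proper_closed_subideal H (K n)) ->
               (forall n, K n `<=` K n.+1) ->
               H <> closure (\bigcup_n K n)].
Proof.
tfae.
- exact: countably_compact_finite_sum.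
- exact: finite_sum_proper_chains.
- exact: proper_chains_countably_compact.
Qed.
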